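(* Let $L_1$ and $L_2$ be finite-dimensional Lie algebras over finite fields $\mathbb{F}_{q_1}$ and $\mathbb{F}_{q_2}$, respectively. Suppose that $G_{L_1}\cong G_{L_2}$ as graphs and that there exists a vertex $x\in V(G_{L_1})$ such that $\deg(x)$ is a prime power, i.e. $\deg(x)=p^n$ for some prime $p$ and some integer $n\geq 1$. Then $q_1=q_2$.
   Context: $\mathbb{F}_q$ denotes the finite field with $q$ elements. For a Lie algebra $L$, $Z(L)=\{x\in L : [x,y]=0 \text{ for all } y\in L\}$ is its centre. The non-commuting graph $G_L$ is the undirected simple graph with vertex set $V(G_L)=L\setminus Z(L)$, in which two distinct vertices $x$ and $y$ are adjacent if and only if $[x,y]\neq 0$. The degree $\deg(x)$ is the number of edges incident to $x$. *)

(* Defs.v *)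
From HB Require Import structures.
From mathcomp Require Import all_boot all_order all_algebra all_field.

Set Implicit Arguments.
Unset Strict Implicit.
Unset Printing Implicit Defensive.

Import GRing.Theory.
Local Open Scope ring_scope.

HB.mixin Record Vector_isLieAlgebra (F : fieldType) L of Vector F L := {
  lie : L -> L -> L;
  lie_linearl : forall y, linear (lie^~ y);
  lie_linearr : forall x, linear (lie x);
  liexx : forall x, lie x x = 0;
  lie_jacobi : forall x y z,
    lie x (lie y z) + lie y (lie z x) + lie z (lie x y) = 0
}.

(* Finite-dimensional Lie algebras: finite dimension comes from vectType. *)
#[short(type="lieAlgType")]
HB.structure Definition LieAlgebra (F : fieldType) :=
  {L of Vector F L & Vector_isLieAlgebra F L}.

Lemma lie_anti (F : fieldType) (L : lieAlgType F) (x y : L) :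
  lie x y = - lie y x.
Proof.
have addl u v w : lie (u + v) w = lie u w + lie v w :> L.
  by have := lie_linearl w 1 u v; rewrite !scale1r.
have addr u v w : lie u (v + w) = lie u v + lie u w :> L.
  by have := lie_linearr u 1 v w; rewrite !scale1r.
apply/eqP; rewrite -addr_eq0; apply/eqP.
by have := liexx (x + y); rewrite addl !addr !liexx add0r addr0.
Qed.

Record sgraph := SGraph {
  vertex :> finType;
  adj : rel vertex;
  adj_sym : symmetric adj;
  adj_irr : irreflexive adj
}.

Definition edges (G : sgraph) : {set {set G}} :=
  [set [set u.1; u.2] | u : G * G & adj u.1 u.2].

Definition deg (G : sgraph) (x : G) : nat := #|[set e in edges G | x \in e]|.

Definition graph_isomorphic (G H : sgraph) : Prop :=
  exists2 f : G -> H, bijective f & forall x y, adj (f x) (f y) = adj x y.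

Lemma degE (G : sgraph) (x : G) : deg x = #|[set y | adj x y]|.
Proof.
have inj : {in [set y | adj x y] &, injective (fun y => [set x; y])}.
  move=> y z; rewrite !inE => xy xz /setP /(_ y).
  rewrite !inE eqxx orbT => /esym/orP[] /eqP yx //.
  by rewrite yx adj_irr in xy.
rewrite -(card_in_imset inj) /deg; apply: eq_card => e.
rewrite inE; apply/andP/imsetP => [[/imsetP[[u v] /= ] ] | [y]].
  rewrite inE /= => uv -> /set2P[] xE; rewrite -xE in uv *;
    first by exists v; rewrite ?inE.
  by exists u; [rewrite inE adj_sym | rewrite setUC].
rewrite inE => xy ->; split; last by rewrite set21.
by apply/imsetP; exists (x, y); rewrite ?inE.
Qed.

Section NonCommutingGraph.
Variables (F : finFieldType) (L : lieAlgType F).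

(* finvect_type L is L itself, equipped with the finType structure it gets as
   a finite-dimensional space over a finite field. *)
Definition lie_center : {set finvect_type L} :=
  [set x : finvect_type L |
    [forall y : finvect_type L, lie (x : L) (y : L) == 0]].

Definition ncg_vertex : finType := {x : finvect_type L | x \notin lie_center}.

Definition ncg_adj : rel ncg_vertex :=
  fun x y => (x != y) && (lie (val x : L) (val y : L) != 0).

Lemma ncg_adj_sym : symmetric ncg_adj.
Proof. by move=> x y; rewrite /ncg_adj eq_sym lie_anti oppr_eq0. Qed.

Lemma ncg_adj_irr : irreflexive ncg_adj.
Proof. by move=> x; rewrite /ncg_adj eqxx. Qed.

Definition non_commuting_graph : sgraph := SGraph ncg_adj_sym ncg_adj_irr.

End NonCommutingGraph.

(* Main.v *)
Require Import Defs.
From HB Require Import structures.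
From mathcomp Require Import all_boot all_order all_algebra all_field.

(** In the non-commuting graph of a Lie algebra [L] over a field with [q]
    elements, the non-neighbours of a vertex [x], together with the centre, form
    the centraliser of [x]. This is the kernel of the linear map [lie x], hence
    a subspace, so that [deg x = q ^ a - q ^ b], where [a] and [b] are the
    dimensions of [L] and of the centraliser ([deg_ncg]). Moreover [0 < b],
    because the centraliser contains the nonzero vector [x], and [b < a],
    because [x] is not central.

    Suppose that [q ^ b * (q ^ (a - b) - 1)] is a power of a prime [p]. Then [p]
    divides [q], since [q ^ b > 1] divides this power; so the second factor is
    both a power of [p] and prime to [p], which makes it [1]. Hence
    [q ^ (a - b) = 2] and [q = 2] ([prime_power_expn_sub]).

    An isomorphism preserves degrees, so each of the two graphs has a vertex of
    prime power degree, and both fields have two elements. *)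

Set Implicit Arguments.
Unset Strict Implicit.
Unset Printing Implicit Defensive.

Import GRing.Theory.

Lemma deg_iso (G H : sgraph) (f : G -> H) (x : G) :
  bijective f -> (forall y z, adj (f y) (f z) = adj y z) -> deg (f x) = deg x.
Proof.
move=> bij_f adj_f; rewrite !degE.
rewrite -(on_card_preimset (onW_bij _ bij_f)).
by apply: eq_card => y; rewrite !inE adj_f.
Qed.

HB.instance Definition _ (F : fieldType) (L : lieAlgType F) (x : L) :=
  GRing.isLinear.Build F L L *:%R (lie x) (lie_linearr x).

Definition centraliser (F : fieldType) (L : lieAlgType F) (x : L) : {vspace L} :=
  lker (linfun (lie x)).

Lemma mem_centraliser (F : fieldType) (L : lieAlgType F) (x y : L) :
  (y \in centraliser x) = (lie x y == 0%R).
Proof. by rewrite memv_ker lfunE. Qed.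

(** The neighbours of [x] are exactly the vectors outside its centraliser:
    restricting the graph to noncentral vectors loses nothing, as a vector that
    does not commute with [x] is not central. *)
Lemma deg_ncg (F : finFieldType) (L : lieAlgType F)
    (x : non_commuting_graph L) :
  deg x = #|F| ^ \dim {: L} - #|F| ^ \dim (centraliser (val x : L)).
Proof.
rewrite degE; set C := centraliser _.
have <- := card_vspace (C : {vspace finvect_type L}).
have <- := card_vspace (fullv : {vspace finvect_type L}).
rewrite card_vspacef -(card_imset _ val_inj).
rewrite -(cardC [in (C : {vspace finvect_type L})]) addKn.
apply: eq_card => y; rewrite !inE mem_centraliser.
apply/imsetP/idP => [[z] | xy]; first by rewrite inE => /andP[_ xz] ->.
have yNZ : y \notin lie_center L.
  rewrite inE; apply/forallPn; exists (val x).
  by rewrite lie_anti oppr_eq0.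
exists (Sub y yNZ) => //; rewrite inE /= /ncg_adj /= xy andbT.
by apply: contraNneq xy => ->; rewrite liexx.
Qed.

Lemma dim_centraliser_gt0 (F : finFieldType) (L : lieAlgType F)
    (x : non_commuting_graph L) : 0 < \dim (centraliser (val x : L)).
Proof.
rewrite lt0n dimv_eq0; apply: contraNneq (valP x) => C0.
have : (val x : L) \in centraliser (val x : L) by rewrite mem_centraliser liexx.
rewrite C0 memv0 => /eqP ->; rewrite inE; apply/forallP => y.
by rewrite lie_anti (linear0 (lie (y : L))) oppr0.
Qed.

Lemma dim_centraliser_lt (F : finFieldType) (L : lieAlgType F)
    (x : non_commuting_graph L) :
  \dim (centraliser (val x : L)) < \dim {: L}.
Proof.
rewrite ltn_neqAle dimvS ?subvf // andbT.
apply: contraNneq (valP x) => dimC; rewrite inE; apply/forallP => y.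
rewrite -mem_centraliser.
have /eqP -> : centraliser (val x : L) == fullv by rewrite eqEdim subvf dimC /=.
exact: memvf.
Qed.

(** Since [q] divides the prime power, [p] divides [q]; the consecutive integers
    [q ^ c - 1] and [q ^ c] being coprime, nothing is left for the former. *)
Lemma prime_power_expn_sub (q b c p n : nat) :
  1 < q -> 0 < b -> 0 < c -> prime p ->
  q ^ b * (q ^ c - 1) = p ^ n -> q = 2.
Proof.
move=> q1 b0 c0 pp pnE.
have q_pn : q %| p ^ n by rewrite -pnE dvdn_mulr // dvdn_exp.
have p_q : p %| q.
  have := dvdn_trans (pdiv_dvd q) q_pn; rewrite Euclid_dvdX ?pdiv_prime //.
  by rewrite dvdn_prime2 ?pdiv_prime // => /andP[/eqP <- _]; apply: pdiv_dvd.
have qcS : (q ^ c - 1).+1 = q ^ c by rewrite subn1 prednK // expn_gt0 ltnW.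
have co_pn : coprime (q ^ c - 1) (p ^ n).
  apply/coprimeXr/(coprime_dvdr (dvdn_trans p_q (dvdn_exp c0 (dvdnn q)))).
  by rewrite -{2}qcS coprimenS.
have : coprime (q ^ c - 1) (q ^ c - 1).
  by apply: coprime_dvdr co_pn; rewrite -pnE dvdn_mull.
rewrite /coprime gcdnn => /eqP qc1; move: qcS; rewrite qc1 => qc2.
have : q %| 2 by rewrite qc2 dvdn_exp.
by move/dvdn_leq => /(_ isT) q2; apply/eqP; rewrite eqn_leq q2.
Qed.

Lemma prime_power_deg_ncg (F : finFieldType) (L : lieAlgType F)
    (x : non_commuting_graph L) (p n : nat) :
  prime p -> deg x = p ^ n -> #|F| = 2.
Proof.
move=> pp degx; have ltCL := dim_centraliser_lt x.
have codim_gt0 : 0 < \dim {: L} - \dim (centraliser (val x : L)).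
  by rewrite subn_gt0.
apply: (prime_power_expn_sub (finNzRing_gt1 F) (dim_centraliser_gt0 x)
          codim_gt0 pp (n := n)).
by rewrite mulnBr muln1 -expnD subnKC ?(ltnW ltCL) // -deg_ncg degx.
Qed.

Theorem theorem4p1 (F1 F2 : finFieldType)
    (L1 : lieAlgType F1) (L2 : lieAlgType F2)
    (isoG : graph_isomorphic (non_commuting_graph L1) (non_commuting_graph L2))
    (ppdeg : exists (x : non_commuting_graph L1) (p n : nat),
        [/\ prime p, 1 <= n & deg x = p ^ n]) :
  #|F1| = #|F2|.
Proof.
have [f bij_f adj_f] := isoG; have [x [p [n [pp _ degx]]]] := ppdeg.
rewrite (prime_power_deg_ncg pp degx); apply/esym.
apply: (prime_power_deg_ncg (x := f x) (n := n) pp).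
by rewrite (deg_iso x bij_f adj_f).
Qed.
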